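(* Let $L$ be a countably infinite semidistributive lattice satisfying Whitman's condition, and assume that every interval in $L$ is finite. Suppose that $L$ has a spanning cover $a \prec b$. Then there exist a partition $L = A \cup B$ of $L$ (with $A \cap B = \varnothing$), with $a \in A$ and $b \in B$, and a sublattice $H = \{(i,k) : i \in 2,\ k \in \mathbb{Z}\} \cong 2 \times \mathbb{Z}$ of $L$ such that $\{(0,k) \in H : k \in \mathbb{Z}\} \subseteq A$, $\{(1,k) \in H : k \in \mathbb{Z}\} \subseteq B$, $a = (0,0)$, $b = (1,0)$, and moreover $B$ satisfies the following, and $A$ satisfies the dual of the following: (1) For all $x \in B \setminus H$ and $k \in \mathbb{Z}$, $x \geq (0,k)$ implies $x \geq (1,k)$. (Dually for $A$: for all $x \in A \setminus H$ and $k \in \mathbb{Z}$, $x \leq (1,k)$ implies $x \leq (0,k)$.) (2) For all $x \in B \setminus H$, letting $H_x$ be the sublattice of $L$ generated by $H \cup \{x\}$, the set $H_x \setminus H$ is finite. (Dually for $A$: for all $x \in A \setminus H$, with $H_x$ the sublattice of $L$ generated by $H \cup \{x\}$, the set $H_x \setminus H$ is finite.) In particular, $A$ and $B$ are sublattices of $L$.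
   Context: Join and meet in a lattice are written $x+y$ and $xy$ respectively; $x \parallel y$ means that $x$ and $y$ are incomparable; $x \prec y$ means that $y$ covers $x$ (i.e. $x<y$ and there is no $z$ with $x<z<y$). An interval of $L$ is a set $[u,v]=\{z \in L : u \le z \le v\}$ with $u \le v$. A lattice $L$ is semidistributive if for all $x,y,z \in L$: $x+y = x+z$ implies $x+y = x+yz$ (law $(SD_\vee)$), and $xy = xz$ implies $xy = x(y+z)$ (law $(SD_\wedge)$). A lattice $L$ satisfies Whitman's condition if for all $p,q,r,s \in L$, $pq \le r+s$ implies that at least one of $p \le r+s$, $q \le r+s$, $pq \le r$, $pq \le s$ holds. A covering pair $a \prec b$ in $L$ is called a spanning cover of $L$ if there are two sequences $(a_i)_{i\ge 1}$ and $(b_j)_{j \ge 1}$ in $L$ such that $a < a_1 < a_2 < a_3 < \dots$ has no upper bound in $L$, $b > b_1 > b_2 > b_3 > \dots$ has no lower bound in $L$, $b \parallel a_k$ for all $k$, and $a \parallel b_k$ for all $k$. Here $2$ denotes the two-element chain $\{0 < 1\}$, $\mathbb{Z}$ denotes the chain $\dots < -2 < -1 < 0 < 1 < 2 < \dots$, and $2 \times \mathbb{Z}$ is their direct product with componentwise order. Writing $H = \{(i,k)\}$ means that $H$ is a sublattice of $L$ together with a fixed lattice isomorphism with $2\times\mathbb{Z}$, and the element of $H$ corresponding to $(i,k) \in 2 \times \mathbb{Z}$ is itself denoted $(i,k)$. *)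

(* Defs.v *)
From mathcomp Require Import all_boot all_order ssralg ssrint.
From mathcomp Require Import boolp classical_sets cardinality.

Set Implicit Arguments.
Unset Strict Implicit.
Unset Printing Implicit Defensive.

Local Open Scope classical_set_scope.

Definition semidistributive (d : Order.disp_t) (L : latticeType d) : Prop :=
  (forall x y z : L, (x `|` y = x `|` z -> x `|` y = x `|` (y `&` z))%O) /\
  (forall x y z : L, (x `&` y = x `&` z -> x `&` y = x `&` (y `|` z))%O).

Definition whitman (d : Order.disp_t) (L : latticeType d) : Prop :=
  forall p q r s : L, (p `&` q <= r `|` s)%O ->
    [\/ (p <= r `|` s)%O, (q <= r `|` s)%O,
        (p `&` q <= r)%O | (p `&` q <= s)%O].

Definition finite_intervals (d : Order.disp_t) (L : latticeType d) : Prop :=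
  forall u v : L, (u <= v)%O -> finite_set [set z : L | (u <= z <= v)%O].

Definition covered_by (d : Order.disp_t) (L : latticeType d) (x y : L) : Prop :=
  (x < y)%O /\ ~ exists z : L, (x < z < y)%O.

(* The sequences a_1, a_2, ... and b_1, b_2, ... are indexed here from 0. *)
Definition spanning_cover (d : Order.disp_t) (L : latticeType d) (a b : L) :
    Prop :=
  covered_by a b /\
  exists u v : nat -> L,
    [/\ (a < u 0)%O, forall k, (u k < u k.+1)%O & ~ has_ubound (range u)] /\
    [/\ (v 0 < b)%O, forall k, (v k.+1 < v k)%O & ~ has_lbound (range v)] /\
    (forall k, (b >< u k)%O) /\ (forall k, (a >< v k)%O).

Definition sublattice (d : Order.disp_t) (L : latticeType d) (S : set L) :
    Prop :=
  S !=set0 /\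
  forall x y : L, S x -> S y -> S (x `&` y)%O /\ S (x `|` y)%O.

Definition generated_sublattice (d : Order.disp_t) (L : latticeType d)
    (G : set L) : set L :=
  smallest (@sublattice d L) G.

(* 2 is bool, with false < true, and [*p] carries the componentwise order. *)
Definition two_by_Z := (bool *p int)%type.

Definition lattice_embedding (d d' : Order.disp_t) (K : latticeType d)
    (L : latticeType d') (h : K -> L) : Prop :=
  [/\ injective h, Order.meet_morphism h & Order.join_morphism h].

(* Main.v *)
Require Import Defs.
From mathcomp Require Import all_boot all_order ssralg ssrint.
From mathcomp Require Import zify.
From mathcomp Require Import boolp classical_sets cardinality.

Set Implicit Arguments.
Unset Strict Implicit.
Unset Printing Implicit Defensive.

Import Order.Theory.

Local Open Scope classical_set_scope.
Local Open Scope card_scope.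
Local Open Scope order_scope.

(** Why the theorem holds.

    Call x avoiding for the cover a < b when a <= x and not b <= x; since b
    covers a this says b x = a, so by the meet law of semidistributivity the
    avoiding elements are closed under joins.  Together with finiteness of
    intervals this gives, below c + b, a greatest avoiding element; replacing
    c by it makes the square a, b, c, c + b and all further ones meet
    correctly.  As L is countable, saturated elements of this kind can be
    arranged in a chain a = c_0 < c_1 < ... which is moreover cofinal among all
    avoiding elements ([cofinal_saturated_chain]).  Taking (0,k) = c_k and
    (1,k) = c_k + b for k >= 0, and the dual chain for k <= 0, yields a copy H
    of 2 x Z, here called a ladder ([spanning_cover_ladder]).  Cofinality is
    the reason for choosing H with care: it makes every element that avoids
    a cover (0,k) < (1,k) of the ladder lie below some (0,n).

    The partition takes for A the elements avoiding at least one cover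
    (0,k) < (1,k), and for B all the others.  Condition (1) for B is then the
    definition of A.  Its dual for A says that an avoiding element below (1,j)
    is below (0,j) ([avoiding_le_lo]): otherwise its join with (0,j) would be
    (1,j), while joins of avoiding elements avoid the cover.  That B is closed
    under joins uses Whitman's condition ([not_avoiding_join]): if x + y avoids
    (0,k) < (1,k), then (0,k) = (0,k+1)(1,k) <= x + y forces
    (0,k+1) <= x + y, hence x + y lies above all the (0,n), and an
    infinite ascent cannot be bounded when intervals are finite.

    Condition (2) rests on the fact that H is both cofinal and coinitial in L
    ([bounded_above], [bounded_below]), which is a second use of Whitman's
    condition: if x >= (1,K) were below no (1,n), the meets x(1,n) would be
    constant from some n on, and (1,m) = (1,m-1) + (0,m) would push this common
    meet below (1,m-1), for m descending past K.  Hence x lies in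
    some interval from (0,K) to (1,N); the union of this interval
    with H is a sublattice, because (1,k) covers (0,k), and so the sublattice
    generated by H and x adds only finitely many elements to H. *)
(** * Duality *)

Lemma semidistributive_dual (d : Order.disp_t) (L : latticeType d) :
  semidistributive L -> semidistributive L^d.
Proof. by case=> sdj sdm; split. Qed.

Lemma whitman_dual (d : Order.disp_t) (L : latticeType d) :
  whitman L -> whitman L^d.
Proof.
move=> W p q r s h.
by case: (W r s p q h); [constructor 3 | constructor 4 | constructor 1 |
  constructor 2].
Qed.

Lemma finite_intervals_dual (d : Order.disp_t) (L : latticeType d) :
  finite_intervals L -> finite_intervals L^d.
Proof.
move=> fi u v uv; apply: sub_finite_set (fi v u uv) => z /= /andP[uz zv].
by apply/andP.
Qed.

Lemma covered_by_dual (d : Order.disp_t) (L : latticeType d) (a b : L) :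
  covered_by a b -> @covered_by _ L^d b a.
Proof.
case=> ab nz; split=> // -[z /andP[bz za]]; apply: nz; exists z.
exact/andP.
Qed.

(** * Elements avoiding a cover *)

Definition avoiding (d : Order.disp_t) (L : latticeType d) (a b x : L) : bool :=
  (a <= x) && ~~ (b <= x).

Lemma cover_cases (d : Order.disp_t) (L : latticeType d) (a b z : L) :
  covered_by a b -> a <= z -> z <= b -> z = a \/ z = b.
Proof.
case=> ab nz az zb; case: (eqVneq z a) => [|za]; first by left.
case: (eqVneq z b) => [|zb']; first by right.
by case: nz; exists z; rewrite !lt_def az zb za eq_sym zb'.
Qed.

(** This form turns the law for meets into closure under joins. *)
Lemma avoidingP (d : Order.disp_t) (L : latticeType d) (a b x : L) :
  covered_by a b -> avoiding a b x <-> b `&` x = a.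
Proof.
move=> cab; have [ab _] := cab; split.
  move=> /andP[ax bx].
  have abx : a <= b `&` x by rewrite lexI (ltW ab).
  have [//|eb] := cover_cases cab abx (leIl _ _).
  by case/negP: bx; rewrite -eb leIr.
move=> e; rewrite /avoiding -e leIr /=; apply/negP => /meet_l bx.
by move: ab; rewrite -e bx ltxx.
Qed.

Lemma avoiding_join (d : Order.disp_t) (L : latticeType d) (a b x y : L) :
  semidistributive L -> covered_by a b ->
  avoiding a b x -> avoiding a b y -> avoiding a b (x `|` y).
Proof.
move=> [_ sdm] cab /(avoidingP _ cab) bx /(avoidingP _ cab) ab_y.
by apply/(avoidingP _ cab); rewrite -(sdm b x y) // bx ab_y.
Qed.

(** * Consequences of finiteness *)

Lemma finite_join_closed_max (d : Order.disp_t) (L : latticeType d) (S : set L)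
    (t : L) :
  finite_set S -> S t -> (forall x y, S x -> S y -> S (x `|` y)) ->
  exists2 s, S s & forall x, S x -> x <= s.
Proof.
move=> /finite_seqP[l ->] tl clo.
suff [s sl hs] : exists2 s, s \in l & {subset l <= fun x => x <= s}.
  by exists s.
have: {subset l <= l} by [].
elim: {1 4}l => [|x l' IH] sub; first by exists t.
have [s sl hs] : exists2 s, s \in l & {subset l' <= fun x => x <= s}.
  by apply: IH => y yl; apply: sub; rewrite inE yl orbT.
have xl : x \in l by apply: sub; rewrite inE eqxx.
exists (x `|` s); first exact: (clo x s xl sl).
move=> y; rewrite inE => /orP[/eqP ->|/hs]; rewrite !unfold_in.
  exact: leUl.
by move=> ys; apply: le_trans ys (leUr _ _).
Qed.

(** The only way in which finiteness of intervals is used for sequences: it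
    excludes both upper bounds of the ladder and meets that never become
    stationary. *)
Lemma no_bounded_ascent (d : Order.disp_t) (L : latticeType d) (f : nat -> L)
    (v : L) :
  finite_intervals L -> (forall n, f n < f n.+1) -> ~ (forall n, f n <= v).
Proof.
move=> fi incr bnd.
have mono : {homo f : m n / (m < n)%N >-> m < n}.
  by apply: (homo_ltn (r := <%O)) incr => y x z; exact: lt_trans.
have inj : injective f.
  by move=> m n e; case: (ltngtP m n) => // /mono; rewrite e ltxx.
have fin : finite_set (f @^-1` [set z | f 0%N <= z <= v]).
  by apply: finite_preimage (fi _ _ (bnd 0%N)) => m n _ _; exact: inj.
apply: infinite_nat; apply: sub_finite_set fin => n _ /=.
rewrite bnd andbT; case: n => // n.
exact/ltW/mono.
Qed.

(** * A cofinal chain of elements avoiding a cover *)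

(** For an avoiding s, this makes s the meet of [s `|` b] with every
    avoiding element above s, which is what the squares of 2 x Z need. *)
Definition saturated (d : Order.disp_t) (L : latticeType d) (a b s : L) :
    Prop :=
  forall z : L, avoiding a b z -> z <= s `|` b -> z <= s.

(** The avoiding elements below [y `|` b] form a finite set closed under joins;
    its greatest element s satisfies [s `|` b = y `|` b], hence is saturated. *)
Lemma avoiding_saturate (d : Order.disp_t) (L : latticeType d) (a b y : L) :
  semidistributive L -> finite_intervals L -> covered_by a b ->
  avoiding a b y ->
  exists s : L, [/\ avoiding a b s, y <= s & saturated a b s].
Proof.
move=> sd fi cab ay.
pose S := [set z : L | avoiding a b z && (z <= y `|` b)].
have Sy : S y by rewrite /S /= ay leUl.
have finS : finite_set S.
  have aU : a <= y `|` b.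
    by case/andP: ay => ay _; apply: le_trans ay (leUl _ _).
  apply: sub_finite_set (fi _ _ aU) => z /andP[/andP[az _] zy] /=.
  by rewrite az zy.
have clo x z : S x -> S z -> S (x `|` z).
  move=> /andP[ax xy] /andP[az zy]; apply/andP; split.
    exact: avoiding_join.
  by rewrite leUx xy zy.
have [s /andP[as_ sy] smax] := finite_join_closed_max finS Sy clo.
exists s; split=> // [|z az zs]; first exact: smax.
apply: smax; apply/andP; split=> //; apply: le_trans zs _.
by rewrite leUx sy leUr.
Qed.

(** The n-th step joins to the chain an avoiding element not below it, to make
    it strict, and the avoiding element of code n, to make it cofinal, and then
    saturates.  This is where countability enters. *)
Lemma cofinal_saturated_chain (d : Order.disp_t) (L : latticeType d) (a b : L) :
  [set: L] #= [set: nat] -> semidistributive L -> finite_intervals L ->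
  covered_by a b ->
  (forall y, avoiding a b y -> exists2 z, avoiding a b z & ~~ (z <= y)) ->
  exists c : nat -> L,
    [/\ c 0 = a, forall n, c n < c n.+1, forall n, avoiding a b (c n),
        forall n, saturated a b (c n) &
        forall y, avoiding a b y -> exists n, y <= c n].
Proof.
move=> Lnat sd fi cab unb; have [ab _] := cab.
have [e einj] : exists e : L -> nat, injective e.
  have /card_set_bijP[e [_ einj _]] := Lnat.
  by exists e => x y exy; apply: einj; rewrite ?inE.
have step (p : nat * L) : exists s : L, avoiding a b p.2 ->
    [/\ avoiding a b s, p.2 < s, saturated a b s &
        forall z, avoiding a b z -> e z = p.1 -> z <= s].
  case: p => n y /=; have [ay|] := boolP (avoiding a b y); last by exists a.
  have [w aw wy] := unb y ay.
  have [t at_ tmax] : exists2 t, avoiding a b t &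
      forall z, avoiding a b z -> e z = n -> z <= t.
    (* Without an avoiding element of code n, adding y again is harmless. *)
    have [[t [at_ et]]|none] := pselect (exists t, avoiding a b t /\ e t = n).
      by exists t => // z _; rewrite -et => /einj ->.
    by exists y => // z az ez; case: none; exists z.
  have ayw : avoiding a b (y `|` w) by exact: avoiding_join.
  have [s [as_ ts sats]] :=
    avoiding_saturate sd fi cab (avoiding_join sd cab ayw at_).
  move: ts; rewrite !leUx => /andP[/andP[ys ws] ts].
  exists s => _; split=> //.
    2: by move=> z az /(tmax z az) zt; apply: le_trans ts.
  rewrite lt_neqAle ys andbT; apply: contraNneq wy => ->.
  exact: ws.
have [g gP] := choice step.
pose c := fix c n := if n is m.+1 then g (m, c m) else a.
have cav n : avoiding a b (c n).
  elim: n => [|n IH] /=; last by case: (gP (n, c n) IH).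
  by rewrite /avoiding lexx lt_geF.
exists c; split=> //.
- by move=> n; case: (gP (n, c n) (cav n)).
- case=> [|n] /=; last by case: (gP (n, c n) (cav n)).
  move=> z /andP[az bz]; rewrite (join_r (ltW ab)) => zb.
  have [->//|eb] := cover_cases cab az zb.
  by rewrite eb lexx in bz.
move=> y ay; exists (e y).+1.
by case: (gP (e y, c (e y)) (cav (e y))) => _ _ _; apply.
Qed.

(** * Ladders: copies of 2 x Z *)

(** A copy of 2 x Z, [lo k] and [hi k] standing for (0,k) and (1,k), given by
    the relations of its squares.  The last two fields are the cofinality
    obtained from countability, in two forms that duality exchanges. *)
Record ladder (d : Order.disp_t) (L : latticeType d) (lo hi : int -> L) :
    Prop := Ladder {
  ladder_lo_lt : forall k, lo k < lo (k + 1)%R;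
  ladder_hi_lt : forall k, hi k < hi (k + 1)%R;
  ladder_cover : forall k, covered_by (lo k) (hi k);
  ladder_meetS : forall k, hi k `&` lo (k + 1)%R = lo k;
  ladder_joinS : forall k, hi k `|` lo (k + 1)%R = hi (k + 1)%R;
  ladder_cofinal : forall k x, lo k <= x -> ~~ (hi k <= x) ->
    exists n, x <= lo n;
  ladder_coinitial : forall k x, x <= hi k -> ~~ (x <= lo k) ->
    exists n, hi n <= x
}.

(** Passing to the dual exchanges the two sides, so indices change sign. *)
Lemma ladder_dual (d : Order.disp_t) (L : latticeType d) (lo hi : int -> L) :
  ladder lo hi ->
  @ladder _ L^d (fun k => hi (- k)%R) (fun k => lo (- k)%R).
Proof.
move=> l; have predK k : (- (k + 1) + 1 = - k :> int)%R by lia.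
split=> k.
- by have := ladder_hi_lt l (- (k + 1))%R; rewrite predK.
- by have := ladder_lo_lt l (- (k + 1))%R; rewrite predK.
- exact: covered_by_dual (ladder_cover l _).
- by have := ladder_joinS l (- (k + 1))%R; rewrite predK joinC.
- by have := ladder_meetS l (- (k + 1))%R; rewrite predK meetC.
- move=> x xh xl; have [n nx] := ladder_coinitial l xh xl.
  by exists (- n)%R; rewrite GRing.opprK.
- move=> x xh xl; have [n nx] := ladder_cofinal l xh xl.
  by exists (- n)%R; rewrite GRing.opprK.
Qed.

Lemma int_le_ind (P : int -> Prop) (j : int) :
  P j -> (forall k, j <= k -> P k -> P (k + 1)%R) -> forall k, j <= k -> P k.
Proof.
move=> Pj PS k jk.
have -> : k = (j + `|k - j|%N%:Z)%R by lia.
elim: `|k - j|%N => [|n IH]; first by rewrite GRing.addr0.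
have -> : (j + n.+1%:Z = j + n%:Z + 1 :> int)%R by lia.
by apply: PS IH; lia.
Qed.

Lemma ladder_lo_le (d : Order.disp_t) (L : latticeType d) (lo hi : int -> L) :
  ladder lo hi -> forall j k, j <= k -> lo j <= lo k.
Proof.
move=> l j; apply: int_le_ind => [|k _ jk]; first exact: lexx.
exact: le_trans jk (ltW (ladder_lo_lt l k)).
Qed.

Lemma ladder_hi_le (d : Order.disp_t) (L : latticeType d) (lo hi : int -> L) :
  ladder lo hi -> forall j k, j <= k -> hi j <= hi k.
Proof.
move=> l j; apply: int_le_ind => [|k _ jk]; first exact: lexx.
exact: le_trans jk (ltW (ladder_hi_lt l k)).
Qed.

Lemma ladder_lo_lt_hi (d : Order.disp_t) (L : latticeType d)
    (lo hi : int -> L) :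
  ladder lo hi -> forall k, lo k < hi k.
Proof. by move=> l k; case: (ladder_cover l k). Qed.

Lemma ladder_meet (d : Order.disp_t) (L : latticeType d) (lo hi : int -> L) :
  ladder lo hi -> forall j k, j <= k -> hi j `&` lo k = lo j.
Proof.
move=> l j; apply: int_le_ind => [|k jk IH].
  exact/meet_r/ltW/ladder_lo_lt_hi.
by rewrite -{1}(meet_l (ladder_hi_le l jk)) -meetA (ladder_meetS l).
Qed.

Lemma ladder_join (d : Order.disp_t) (L : latticeType d) (lo hi : int -> L) :
  ladder lo hi -> forall j k, j <= k -> hi j `|` lo k = hi k.
Proof.
move=> l j; apply: int_le_ind => [|k jk IH].
  exact/join_l/ltW/ladder_lo_lt_hi.
by rewrite -(ladder_joinS l k) -IH -joinA (join_r (ltW (ladder_lo_lt l k))).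
Qed.

Lemma ladder_lo_le_hi (d : Order.disp_t) (L : latticeType d)
    (lo hi : int -> L) :
  ladder lo hi -> forall j k, (lo j <= hi k) = (j <= k).
Proof.
move=> l j k; apply/idP/idP => [jk|jk]; last first.
  exact: le_trans (ladder_lo_le l jk) (ltW (ladder_lo_lt_hi l k)).
rewrite leNgt; apply/negP => kj.
have := ladder_meet l (ltW kj); rewrite (meet_r jk) => e.
have : (k + 1 <= j)%R by lia.
by move=> /(ladder_lo_le l); rewrite e lt_geF // (ladder_lo_lt l).
Qed.

Lemma ladder_hi_nle_lo (d : Order.disp_t) (L : latticeType d)
    (lo hi : int -> L) :
  ladder lo hi -> forall j k, hi j <= lo k = false.
Proof.
move=> l j k; apply/negP => hl.
have [jk|/ltW kj] := leP j k.
  by have := ladder_lo_lt_hi l j; rewrite -(ladder_meet l jk) (meet_l hl) ltxx.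
have := le_trans (ladder_hi_le l kj) hl.
by rewrite lt_geF // (ladder_lo_lt_hi l).
Qed.

Lemma ladder_unbounded (d : Order.disp_t) (L : latticeType d)
    (lo hi : int -> L) (x : L) (j : int) :
  finite_intervals L -> ladder lo hi -> exists2 k, j <= k & ~~ (lo k <= x).
Proof.
move=> fi l; have [//|none] := pselect (exists2 k, j <= k & ~~ (lo k <= x)).
have incr n : lo (j + n%:Z)%R < lo (j + n.+1%:Z)%R.
  have -> : (j + n.+1%:Z = j + n%:Z + 1 :> int)%R by lia.
  exact: ladder_lo_lt l _.
case: (no_bounded_ascent fi incr (v := x)) => n.
apply: contraT => nx; case: none.
by exists (j + n%:Z)%R => //; lia.
Qed.

(** If x were not below [lo j], then [x `|` lo j] would be [hi j] as [hi j]
    covers [lo j]; but x and [lo j] both avoid the k-th cover, hence so does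
    their join. *)
Lemma avoiding_le_lo (d : Order.disp_t) (L : latticeType d) (lo hi : int -> L)
    (j k : int) (x : L) :
  semidistributive L -> ladder lo hi ->
  avoiding (lo k) (hi k) x -> x <= hi j -> x <= lo j.
Proof.
move=> sd l ax xj; have kj : k <= j.
  by rewrite -(ladder_lo_le_hi l); case/andP: ax => kx _; apply: le_trans xj.
have aj : avoiding (lo k) (hi k) (lo j).
  by rewrite /avoiding (ladder_lo_le l kj) (ladder_hi_nle_lo l).
have /andP[_] := avoiding_join sd (ladder_cover l k) ax aj.
have [|<-|->] := cover_cases (z := x `|` lo j) (ladder_cover l j) (leUr _ _).
- by rewrite leUx xj ltW // (ladder_lo_lt_hi l).
- by rewrite leUl.
by rewrite (ladder_hi_le l kj).
Qed.

(** Since [hi k] is [hi j `|` lo k], an element above [lo k] and [hi j] is above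
    [hi k]. *)
Lemma avoiding_antimono (d : Order.disp_t) (L : latticeType d)
    (lo hi : int -> L) (j k : int) (x : L) :
  ladder lo hi -> j <= k ->
  avoiding (lo k) (hi k) x -> avoiding (lo j) (hi j) x.
Proof.
move=> l jk /andP[kx nkx]; apply/andP; split.
  exact: le_trans (ladder_lo_le l jk) kx.
by apply: contra nkx => jx; rewrite -(ladder_join l jk) leUx jx kx.
Qed.

(** * Consequences of Whitman's condition *)

(** Otherwise the meets of x with the [hi n] become stationary, at a value below
    some [hi n].  By Whitman's condition applied to the decomposition of [hi n]
    as a join, this value is below [hi (n - 1)], and so on down to
    [hi (K - 1)]; but it is above [hi K]. *)
Lemma above_hi_bounded (d : Order.disp_t) (L : latticeType d)
    (lo hi : int -> L) (K : int) (x : L) :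
  whitman L -> finite_intervals L -> ladder lo hi ->
  hi K <= x -> exists n, x <= hi n.
Proof.
move=> W fi l Kx; have [//|none] := pselect (exists n, x <= hi n).
have nle n : ~~ (x <= hi n) by apply/negP => xn; apply: none; exists n.
pose f n := x `&` hi (K + n%:Z)%R.
have [n fn] : exists n, ~~ (f n < f n.+1).
  apply: contrapT => /forallNP incr.
  apply: (no_bounded_ascent fi (f := f) (v := x)) => n; last exact: leIl.
  by apply/negPn/negP; apply: incr.
have fS : f n.+1 <= hi (K + n%:Z)%R.
  have le_f : f n <= f n.+1.
    by rewrite leI2 // (ladder_hi_le l) //; lia.
  by move: fn; rewrite lt_neqAle le_f andbT negbK => /eqP <-; apply: leIr.
have Kf : hi K <= f n.+1 by rewrite lexI Kx (ladder_hi_le l) //; lia.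
(* The meet is kept at index n.+1: its factor [hi (K + n.+1)] lies below none of
   the joins met on the way down. *)
have desc m : f n.+1 <= hi (K + n%:Z - m%:Z)%R.
  elim: m => [|m IH]; first by rewrite GRing.subr0.
  set p := (K + n%:Z - m.+1%:Z)%R.
  have ep : (K + n%:Z - m%:Z = p + 1)%R by rewrite /p; lia.
  rewrite ep -(ladder_joinS l) in IH.
  have [||//|le_lo] := W _ _ _ _ IH; rewrite ?(ladder_joinS l).
  - by rewrite (negPf (nle _)).
  - rewrite lt_geF //; apply: lt_le_trans (ladder_hi_lt l _) _.
    by apply: ladder_hi_le l _ _ _; rewrite /p; lia.
  by have := le_trans Kf le_lo; rewrite (ladder_hi_nle_lo l).
have := le_trans Kf (desc n.+1).
have -> : (K + n%:Z - n.+1%:Z = K - 1)%R by lia.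
rewrite lt_geF //; have := ladder_hi_lt l (K - 1)%R.
by rewrite GRing.subrK.
Qed.

(** Joining x with [lo 0] leaves only two cases: the join avoids the cover at 0,
    and cofinality applies, or it is above [hi 0]. *)
Lemma bounded_above (d : Order.disp_t) (L : latticeType d)
    (lo hi : int -> L) (x : L) :
  whitman L -> finite_intervals L -> ladder lo hi -> exists n, x <= hi n.
Proof.
move=> W fi l; suff [n xn] : exists n, x `|` lo 0%R <= hi n.
  by exists n; apply: le_trans (leUl _ _) xn.
have [hx|hx] := boolP (hi 0%R <= x `|` lo 0%R).
  exact: above_hi_bounded W fi l hx.
have [n xn] := ladder_cofinal l (leUr _ _) hx; exists n.
exact: le_trans xn (ltW (ladder_lo_lt_hi l n)).
Qed.

Lemma bounded_below (d : Order.disp_t) (L : latticeType d)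
    (lo hi : int -> L) (x : L) :
  whitman L -> finite_intervals L -> ladder lo hi -> exists n, lo n <= x.
Proof.
move=> W fi l; have [n nx] := @bounded_above _ L^d _ _ x (whitman_dual W)
  (finite_intervals_dual fi) (ladder_dual l).
by exists (- n)%R.
Qed.

(** Whitman's condition, applied to [lo m] as the meet of [hi m] and
    [lo (m + 1)], lets [x `|` y] climb the lower side of the ladder without end
    as soon as neither x nor y is above [lo m]. *)
Lemma not_avoiding_join (d : Order.disp_t) (L : latticeType d)
    (lo hi : int -> L) (x y : L) :
  whitman L -> finite_intervals L -> ladder lo hi ->
  (forall k, ~~ avoiding (lo k) (hi k) x) ->
  (forall k, ~~ avoiding (lo k) (hi k) y) ->
  forall k, ~~ avoiding (lo k) (hi k) (x `|` y).
Proof.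
move=> W fi l nx ny k; apply/negP => /andP[kxy nkxy].
have [m km] := ladder_unbounded (x `|` y) k fi l.
apply/negP; rewrite negbK; move: m km.
apply: int_le_ind => // m km IH.
have nm : ~~ (hi m <= x `|` y).
  by apply: contra nkxy; apply: le_trans; apply: ladder_hi_le l _ _ km.
have W1 : hi m `&` lo (m + 1)%R <= x `|` y by rewrite (ladder_meetS l).
case: (W _ _ _ _ W1) => //; first by rewrite (negPf nm).
- rewrite (ladder_meetS l) => mx; have := nx m; rewrite /avoiding mx negbK.
  by move=> hx; case/negP: nm; apply: le_trans hx (leUl _ _).
rewrite (ladder_meetS l) => my; have := ny m; rewrite /avoiding my negbK.
by move=> hy; case/negP: nm; apply: le_trans hy (leUr _ _).
Qed.

(** * Building a ladder on a spanning cover *)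

(** The nonnegative half is a cofinal saturated chain above a joined with b; the
    negative half is the dual chain below b met with a.  The sequences of the
    spanning cover only serve to show that neither chain stops. *)
Lemma spanning_cover_ladder (d : Order.disp_t) (L : latticeType d) (a b : L) :
  [set: L] #= [set: nat] -> semidistributive L -> finite_intervals L ->
  spanning_cover a b ->
  exists lo hi : int -> L, [/\ ladder lo hi, lo 0%R = a & hi 0%R = b].
Proof.
move=> Lnat sd fi [cab [u [v [[au uS nubu] [[vb vS nlbv] [bu av]]]]]].
have [ab _] := cab.
have [c [c0 cS cav csat ccof]] : exists c : nat -> L,
    [/\ c 0 = a, forall n, c n < c n.+1, forall n, avoiding a b (c n),
        forall n, saturated a b (c n) &
        forall y, avoiding a b y -> exists n, y <= c n].
  apply: cofinal_saturated_chain => // y _.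
  have [//|none] := pselect (exists2 z, avoiding a b z & ~~ (z <= y)).
  case: nubu; exists y => _ [n _ <-]; apply: contraT => ny; case: none.
  exists (u n) => //; apply/andP; split; last first.
    by apply: contra (bu n) => bun; apply/orP; left.
  by elim: {ny} n => [|n IH]; [exact: ltW | apply: le_trans IH (ltW (uS n))].
have [e [e0 eS eav esat ecoi]] : exists e : nat -> L,
    [/\ e 0 = b, forall n, e n.+1 < e n,
        forall n, (e n <= b) && ~~ (e n <= a),
        forall n z, (z <= b) && ~~ (z <= a) -> e n `&` a <= z -> e n <= z &
        forall z, (z <= b) && ~~ (z <= a) -> exists n, e n <= z].
  apply: (@cofinal_saturated_chain _ L^d b a) => //.
  - exact: semidistributive_dual.
  - exact: finite_intervals_dual.
  - exact: covered_by_dual.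
  move=> y _.
  have [//|none] :=
    pselect (exists2 z : L^d, avoiding (b : L^d) a z & ~~ (z <= y)).
  case: nlbv; exists y => _ [n _ <-]; apply: contraT => ny; case: none.
  exists (v n) => //; apply/andP; split; last first.
    by apply: contra (av n) => van; apply/orP; right.
  by elim: {ny} n => [|n IH]; [exact: ltW | apply: le_trans (ltW (vS n)) IH].
pose lo k := match k with Posz n => c n | Negz n => e n.+1 `&` a end.
pose hi k := match k with Posz n => c n `|` b | Negz n => e n.+1 end.
exists lo, hi; split=> //; last by rewrite /= c0 join_r // ltW.
have PoszS n : (n%:Z + 1 = n.+1%:Z :> int)%R by lia.
have NegzS n : (Negz n.+1 + 1 = Negz n :> int)%R by lia.
have Negz0 : (Negz 0 + 1 = 0%:Z :> int)%R by lia.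
have ca n : a <= c n by case/andP: (cav n).
have nbc n : ~~ (b <= c n) by case/andP: (cav n).
have eb n : e n <= b by case/andP: (eav n).
have nea n : ~~ (e n <= a) by case/andP: (eav n).
have eaE n : e n `|` a = b.
  have le_b : e n `|` a <= b by rewrite leUx eb ltW.
  have [ea|//] := cover_cases cab (leUr _ _) le_b.
  by case/negP: (nea n); rewrite -ea leUl.
(* Apart from the square around 0, both relations are either immediate or the
   saturation of one of the two chains. *)
have meetS k : hi k `&` lo (k + 1)%R = lo k.
  case: k => [n|[|n]].
  - rewrite PoszS /=; apply/eqP; rewrite eq_le; apply/andP; split.
      apply: csat; last exact: leIl.
      apply/andP; split; first by rewrite lexI ca (le_trans (ca n) (leUl _ _)).
      by apply: contra (nbc n.+1) => h; apply: le_trans h (leIr _ _).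
    by rewrite lexI leUl ltW.
  - by rewrite Negz0 /= c0.
  by rewrite NegzS /= meetA (meet_l (ltW (eS _))).
have joinS k : hi k `|` lo (k + 1)%R = hi (k + 1)%R.
  case: k => [n|[|n]].
  - by rewrite PoszS /= joinAC (join_r (ltW (cS n))).
  - by rewrite Negz0 /= c0 eaE join_r // ltW.
  rewrite NegzS /=; apply/eqP; rewrite eq_le; apply/andP; split.
    by rewrite leUx leIl ltW.
  apply: esat; last exact: leUr.
  apply/andP; split; last first.
    by apply: contra (nea n.+2) => h; apply: le_trans (leUl _ _) h.
  by rewrite leUx eb (le_trans (leIl _ _) (eb _)).
have lo_le_hi k : lo k <= hi k by rewrite -meetS leIl.
have nhl k : ~~ (hi k <= lo k).
  case: k => n /=.
    by apply: contra (nbc n) => h; apply: le_trans (leUr _ _) h.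
  by apply: contra (nea n.+1) => h; apply: le_trans h (leIr _ _).
have cover k : covered_by (lo k) (hi k).
  split.
    by rewrite lt_leAnge lo_le_hi nhl.
  case=> z; case: k => n /= /andP[lz zh].
    case/negP: (lt_geF lz); apply: csat (ltW zh).
    apply/andP; split; first exact: le_trans (ca n) (ltW lz).
    apply: contraTN zh => bz.
    by rewrite le_gtF // leUx bz ltW.
  case/negP: (lt_geF zh); apply: esat (ltW lz).
  apply/andP; split; first exact: le_trans (ltW zh) (eb _).
  apply: contraTN lz => za.
  by rewrite le_gtF // lexI za ltW.
(* In a square of this shape one side is strict as soon as the other one is. *)
have lo_lt k : lo k < lo (k + 1)%R.
  have le1 : lo k <= lo (k + 1)%R by rewrite -meetS leIr.
  rewrite lt_neqAle le1 andbT; apply/eqP => ek.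
  have : hi (k + 1)%R = hi k by rewrite -joinS -ek join_l.
  case: k {le1} ek => [n|[|n]].
  - by rewrite PoszS => /eqP; rewrite (lt_eqF (cS n)).
  - move=> _; rewrite Negz0 /= c0 join_r ?ltW // -e0 => /eqP.
    by rewrite (gt_eqF (eS 0)).
  by move=> _; rewrite NegzS /= => /eqP; rewrite (gt_eqF (eS _)).
have hi_lt k : hi k < hi (k + 1)%R.
  have le1 : hi k <= hi (k + 1)%R by rewrite -joinS leUl.
  rewrite lt_neqAle le1 andbT; apply: contraTneq (lo_lt k) => ek.
  by rewrite -(meetS k) ek (meet_r (lo_le_hi _)) ltxx.
split=> // [k x lx nhx|k x xh nxl].
  (* Joining with a moves x from the k-th cover to the cover at 0, whose
     avoiding elements the chain c dominates. *)
  suff axa : avoiding a b (x `|` a).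
    have [n xn] := ccof _ axa; exists (Posz n).
    exact: le_trans (leUl _ _) xn.
  rewrite /avoiding leUr /=; case: k lx nhx => n /= lx nhx.
    rewrite (join_l (le_trans (ca n) lx)).
    by apply: contra nhx => bx; rewrite leUx lx bx.
  have /andP[_] : avoiding (lo (Negz n)) (hi (Negz n)) (x `|` a).
    apply: avoiding_join => //; apply/andP; split=> //; first exact: leIr.
    exact: nea.
  by apply: contra => h; apply: le_trans (eb _) h.
suff axb : (x `&` b <= b) && ~~ (x `&` b <= a).
  have [n nx] := ecoi _ axb.
  exists (if n is m.+1 then Negz m else 0%R).
  have -> : hi (if n is m.+1 then Negz m else 0%R) = e n.
    by case: (n) => //=; rewrite c0 join_r ?ltW // e0.
  exact: le_trans nx (leIl _ _).
rewrite leIr /=; case: k xh nxl => n /= xh nxl; last first.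
  rewrite (meet_l (le_trans xh (eb _))).
  by apply: contra nxl => xa; rewrite lexI xh xa.
have /andP[_] : @avoiding _ L^d (hi n) (lo n) (x `&` b).
  apply: (@avoiding_join _ L^d) => //.
  - exact: semidistributive_dual.
  - exact: covered_by_dual.
  - exact/andP.
  by apply/andP; split; [exact: leUr | exact: nbc].
by apply: contra => h; apply: le_trans h (ca n).
Qed.

(** * The copy of 2 x Z and the sublattices generated over it *)

Definition rung (d : Order.disp_t) (L : latticeType d) (lo hi : int -> L)
    (p : two_by_Z) : L :=
  if p.1 then hi p.2 else lo p.2.

Lemma rung_embedding (d : Order.disp_t) (L : latticeType d)
    (lo hi : int -> L) :
  ladder lo hi -> lattice_embedding (rung lo hi).
Proof.
move=> l; have lh k := ltW (ladder_lo_lt_hi l k).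
have meetE j k : j <= k -> [/\ hi j `&` hi k = hi j, hi j `&` lo k = lo j,
    lo j `&` hi k = lo j & lo j `&` lo k = lo j].
  move=> jk; split; first by apply: meet_l; apply: ladder_hi_le l _ _ jk.
  - exact: ladder_meet.
  - by rewrite meet_l // (ladder_lo_le_hi l).
  by apply: meet_l; apply: ladder_lo_le l _ _ jk.
have joinE j k : j <= k -> [/\ hi j `|` hi k = hi k, hi j `|` lo k = hi k,
    lo j `|` hi k = hi k & lo j `|` lo k = lo k].
  move=> jk; split; first by apply: join_r; apply: ladder_hi_le l _ _ jk.
  - exact: ladder_join.
  - by rewrite join_r // (ladder_lo_le_hi l).
  by apply: join_r; apply: ladder_lo_le l _ _ jk.
split.
- case=> [[] j] [[] k]; rewrite /rung /= => e.
  + suff -> : j = k by [].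
    by apply/eqP; rewrite eq_le -!(ladder_lo_le_hi l) -e lh e lh.
  + by have := ladder_hi_nle_lo l j k; rewrite e lexx.
  + by have := ladder_hi_nle_lo l k j; rewrite e lexx.
  suff -> : j = k by [].
  by apply/eqP; rewrite eq_le -!(ladder_lo_le_hi l) -e lh e lh.
- case=> [i j] [i' k]; rewrite /rung /=.
  have [jk|/ltW jk] := leP j k; have [e1 e2 e3 e4] := meetE _ _ jk;
    by case: i i' => [] [] //=; rewrite meetC.
case=> [i j] [i' k]; rewrite /rung /=.
have [jk|/ltW jk] := leP j k; have [e1 e2 e3 e4] := joinE _ _ jk;
  by case: i i' => [] [] //=; rewrite joinC.
Qed.

(** Membership in the range of [rung], in a form that duality preserves. *)
Definition on_ladder (d : Order.disp_t) (L : latticeType d) (lo hi : int -> L)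
    (z : L) : Prop :=
  exists k, z = lo k \/ z = hi k.

(** The interval and the ladder together form a sublattice: when the rung is too
    high for the join to stay in the interval, the join is squeezed between
    [lo k] and [hi k], and these form a cover. *)
Lemma join_near_ladder (d : Order.disp_t) (L : latticeType d)
    (lo hi : int -> L) (K N : int) (x y : L) :
  ladder lo hi -> lo K <= x <= hi N -> on_ladder lo hi y ->
  lo K <= x `|` y <= hi N \/ on_ladder lo hi (x `|` y).
Proof.
move=> l /andP[Kx xN] [k yk].
have Kxy : lo K <= x `|` y by apply: le_trans Kx (leUl _ _).
have lh := ltW (ladder_lo_lt_hi l k).
have [yh ly] : y <= hi k /\ lo k <= y by case: yk => ->.
have [kN|/ltW Nk] := leP k N.
  by left; rewrite Kxy leUx xN (le_trans yh) // (ladder_hi_le l).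
right; exists k; apply: cover_cases (ladder_cover l k) _ _.
  exact: le_trans ly (leUr _ _).
by rewrite leUx yh (le_trans xN) // (ladder_hi_le l).
Qed.

Lemma meet_near_ladder (d : Order.disp_t) (L : latticeType d)
    (lo hi : int -> L) (K N : int) (x y : L) :
  ladder lo hi -> lo K <= x <= hi N -> on_ladder lo hi y ->
  lo K <= x `&` y <= hi N \/ on_ladder lo hi (x `&` y).
Proof.
move=> l /andP[Kx xN] [k yk].
have [||/andP[h1 h2]|[j ej]] := @join_near_ladder _ L^d _ _ (- N)%R (- K)%R x y
    (ladder_dual l).
- by rewrite !GRing.opprK; apply/andP.
- by exists (- k)%R; rewrite GRing.opprK; case: yk; [right | left].
- by rewrite !GRing.opprK in h1 h2; left; apply/andP.
by right; exists (- j)%R; case: ej; [right | left].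
Qed.

Lemma range_rung (d : Order.disp_t) (L : latticeType d) (lo hi : int -> L) :
  range (rung lo hi) = on_ladder lo hi.
Proof.
apply/seteqP; split=> [_ [[[] k] _ <-]|_ [k [->|->]]].
- by exists k; right.
- by exists k; left.
- by exists (false, k).
by exists (true, k).
Qed.

Lemma generated_over_ladder_finite (d : Order.disp_t) (L : latticeType d)
    (lo hi : int -> L) (x : L) :
  whitman L -> finite_intervals L -> ladder lo hi ->
  finite_set (generated_sublattice (range (rung lo hi) `|` [set x])
                `\` range (rung lo hi)).
Proof.
move=> W fi l; rewrite range_rung.
have [K Kx] := bounded_below x W fi l; have [N xN] := bounded_above x W fi l.
have [_ hmeet hjoin] := rung_embedding l.
have Hclo y z : on_ladder lo hi y -> on_ladder lo hi z ->
    on_ladder lo hi (y `&` z) /\ on_ladder lo hi (y `|` z).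
  rewrite -range_rung => -[p _ <-] [q _ <-].
  by split; [exists (p `&` q) | exists (p `|` q)].
pose I := [set z | lo K <= z <= hi N].
have finI : finite_set I by apply: fi; apply: le_trans xN.
apply: sub_finite_set finI => z [gz nz].
suff [//|/nz//] : (I `|` on_ladder lo hi) z.
apply: gz; split; last first.
  by move=> y [Hy|->]; [right | left; rewrite /I /= Kx xN].
split; first by exists x; left; rewrite /I /= Kx xN.
move=> y w [Iy|Hy] [Iw|Hw].
- move: Iy Iw; rewrite /I /= => /andP[Ky yN] /andP[Kw wN]; split; left => /=.
    by rewrite lexI Ky Kw (le_trans (leIl _ _) yN).
  by rewrite leUx yN wN (le_trans Ky (leUl _ _)).
- by split; [exact: meet_near_ladder l Iy Hw | exact: join_near_ladder l Iy Hw].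
- rewrite (meetC y) (joinC y).
  by split; [exact: meet_near_ladder l Iw Hy | exact: join_near_ladder l Iw Hy].
by have [] := Hclo y w Hy Hw; split; right.
Qed.

(** * The partition *)

Local Close Scope order_scope.

Theorem theorem4 (d : Order.disp_t) (L : latticeType d) (a b : L) :
  [set: L] #= [set: nat] ->
  semidistributive L ->
  whitman L ->
  finite_intervals L ->
  spanning_cover a b ->
  exists (A B : set L) (h : two_by_Z -> L),
    let H := range h in
    (A `|` B = [set: L] /\ A `&` B = set0) /\
    (A a /\ B b) /\
    lattice_embedding h /\
    (forall k : int, A (h (false, k)) /\ B (h (true, k))) /\
    (h (false, 0%R) = a /\ h (true, 0%R) = b) /\
    ((forall x : L, (B `\` H) x -> forall k : int,
        (h (false, k) <= x)%O -> (h (true, k) <= x)%O) /\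
     (forall x : L, (B `\` H) x ->
        finite_set (generated_sublattice (H `|` [set x]) `\` H))) /\
    ((forall x : L, (A `\` H) x -> forall k : int,
        (x <= h (true, k))%O -> (x <= h (false, k))%O) /\
     (forall x : L, (A `\` H) x ->
        finite_set (generated_sublattice (H `|` [set x]) `\` H))) /\
    (sublattice A /\ sublattice B).
Proof.
move=> Lnat sd W fi sp.
have [lo [hi [l lo0 hi0]]] := spanning_cover_ladder Lnat sd fi sp.
pose A : set L := [set x | exists k, avoiding (lo k) (hi k) x].
have Alo k : A (lo k) by exists k; rewrite /avoiding lexx (ladder_hi_nle_lo l).
have Bhi k : ~ A (hi k).
  move=> [j /(avoiding_le_lo sd l)/(_ (lexx _))].
  by rewrite (ladder_hi_nle_lo l).
have Bge x k : ~ A x -> (lo k <= x)%O -> (hi k <= x)%O.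
  by move=> nAx kx; apply/negPn/negP => nkx; apply: nAx; exists k; apply/andP.
exists A, (~` A), (rung lo hi) => H.
split; first by rewrite setUv setICr.
split; first by rewrite -lo0 -hi0; split; [exact: Alo | exact: Bhi].
split; first exact: rung_embedding.
split; first by move=> k; split; [exact: Alo | exact: Bhi].
split; first by [].
split.
  split=> [x [Bx _] k|x _]; first exact: Bge.
  exact: generated_over_ladder_finite.
split.
  split=> [x [[j Ax] _] k|x _]; first exact: avoiding_le_lo Ax.
  exact: generated_over_ladder_finite.
split; split.
- by exists a; rewrite -lo0.
- move=> x y [j ax] [k ay].
  have [m [ax' ay']] : exists m, avoiding (lo m) (hi m) x /\
      avoiding (lo m) (hi m) y.
    have [jk|/ltW kj] := leP j k.
      by exists j; split=> //; apply: avoiding_antimono ay.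
    by exists k; split=> //; apply: avoiding_antimono ax.
  split; exists m; last exact: avoiding_join (ladder_cover l m) ax' ay'.
  move: ax' ay' => /andP[mx nmx] /andP[my nmy].
  by rewrite /avoiding !lexI mx my negb_and nmx.
- by exists b; rewrite -hi0; apply: Bhi.
move=> x y nx ny; split.
  move=> [k /andP[kxy /negP[]]]; move: kxy; rewrite !lexI => /andP[kx ky].
  by rewrite !Bge.
have na z : ~ A z -> forall k, ~~ avoiding (lo k) (hi k) z.
  by move=> nz k; apply/negP => az; apply: nz; exists k.
move=> [k axy].
by have /negP := not_avoiding_join W fi l (na x nx) (na y ny) k.
Qed.
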